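(* Let $X$ be a set and let $\mathcal{G}$ be a pseudogroup of transformations of $X$. Then $\mathcal{G}$ is amenable if and only if $(\mathcal{G},X)$ satisfies the Følner condition.
   Context: A pseudogroup $\mathcal{G}$ of transformations of a set $X$ is a set of bijections $\gamma\colon S\to T$ between subsets $S,T$ of $X$ such that: (i) the identity $X\to X$ is in $\mathcal{G}$; (ii) if $\gamma\colon S\to T$ is in $\mathcal{G}$, so is $\gamma^{-1}\colon T\to S$; (iii) if $\gamma\colon S\to T$ and $\delta\colon T\to U$ are in $\mathcal{G}$, so is $\delta\gamma\colon S\to U$; (iv) if $\gamma\colon S\to T$ is in $\mathcal{G}$ and $S'\subset S$, then the restriction $\gamma|_{S'}\colon S'\to\gamma(S')$ is in $\mathcal{G}$; (v) if $\gamma\colon S\to T$ is a bijection between two subsets of $X$ and there is a finite partition $S=\bigsqcup_{1\le j\le n}S_j$ with each $\gamma|_{S_j}$ (viewed as a bijection $S_j\to\gamma(S_j)$) in $\mathcal{G}$, then $\gamma\in\mathcal{G}$. For $\gamma\colon S\to T$ in $\mathcal{G}$ write $\alpha(\gamma)=S$ and $\omega(\gamma)=T$. The pseudogroup $\mathcal{G}$ is amenable if there exists a $\mathcal{G}$-invariant mean on $X$, i.e. a map $\mu$ from the set $\mathcal{P}(X)$ of all subsets of $X$ to $[0,1]$ that is finitely additive ($\mu(S_1\cup S_2)=\mu(S_1)+\mu(S_2)$ whenever $S_1\cap S_2=\emptyset$), invariant ($\mu(\omega(\gamma))=\mu(\alpha(\gamma))$ for all $\gamma\in\mathcal{G}$),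 and normalized ($\mu(X)=1$). For $\mathcal{R}\subset\mathcal{G}$ and $A\subset X$, the $\mathcal{R}$-boundary of $A$ is $\partial_{\mathcal{R}}A=\{x\in X\setminus A : \text{there exists }\rho\in\mathcal{R}\cup\mathcal{R}^{-1}\text{ with }x\in\alpha(\rho)\text{ and }\rho(x)\in A\}$. The pseudogroup $(\mathcal{G},X)$ satisfies the Følner condition if for every finite subset $\mathcal{R}$ of $\mathcal{G}$ and every real $\epsilon>0$ there exists a finite non-empty subset $F$ of $X$ with $|\partial_{\mathcal{R}}F|<\epsilon|F|$. *)

(* Defs.v *)
From mathcomp Require Import all_boot all_order all_algebra.
From mathcomp Require Import finmap.
From mathcomp Require Import boolp classical_sets functions cardinality reals.

Set Implicit Arguments.
Unset Strict Implicit.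
Unset Printing Implicit Defensive.

Import Order.TTheory GRing.Theory Num.Theory.

Local Open Scope classical_set_scope.
Local Open Scope ring_scope.

(* A bijection between two subsets S, T of X is represented by its graph
   g : set (X * X), so that equality of partial bijections is equality of sets.
   A graph that is single-valued and injective is exactly a bijection from
   alpha g onto omega g, because totality and surjectivity then hold by
   definition of alpha and omega. *)
Definition alpha (X : Type) (g : set (X * X)) : set X := g.`1.

Definition omega (X : Type) (g : set (X * X)) : set X := g.`2.

Definition partial_bij (X : Type) (g : set (X * X)) : Prop :=
  (forall x y y', g (x, y) -> g (x, y') -> y = y') /\
  (forall x x' y, g (x, y) -> g (x', y) -> x = x').

Definition inv_graph (X : Type) (g : set (X * X)) : set (X * X) :=
  (g^-1)%relation.

(* The library's d \; g applies g first. *)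
Definition comp_graph (X : Type) (d g : set (X * X)) : set (X * X) :=
  (d \; g)%relation.

Definition restr_graph (X : Type) (g : set (X * X)) (S : set X) :
    set (X * X) :=
  [set xy | g xy /\ S xy.1].

Record is_pseudogroup (X : Type) (G : set (set (X * X))) : Prop := {
  pseudogroup_bij : forall g, G g -> partial_bij g;
  pseudogroup_id : G diagonal;
  pseudogroup_inv : forall g, G g -> G (inv_graph g);
  pseudogroup_comp : forall g d, G g -> G d ->
    omega g = alpha d -> G (comp_graph d g);
  pseudogroup_restr : forall g (S' : set X), G g ->
    S' `<=` alpha g -> G (restr_graph g S');
  pseudogroup_glue : forall g (n : nat) (S : 'I_n -> set X), partial_bij g ->
    partition [set: 'I_n] S (alpha g) ->
    (forall j, G (restr_graph g (S j))) -> G g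
}.

Record is_invariant_mean (R : realType) (X : Type) (G : set (set (X * X)))
    (mu : set X -> R) : Prop := {
  mean_range : forall S, 0 <= mu S <= 1;
  mean_additive : forall S1 S2, S1 `&` S2 = set0 ->
    mu (S1 `|` S2) = mu S1 + mu S2;
  mean_invariant : forall g, G g -> mu (omega g) = mu (alpha g);
  mean_normalized : mu [set: X] = 1
}.

Definition amenable (R : realType) (X : Type) (G : set (set (X * X))) : Prop :=
  exists mu : set X -> R, is_invariant_mean G mu.

Definition boundary (X : Type) (Rs : set (set (X * X))) (A : set X) : set X :=
  [set x | ~ A x /\
    exists2 r, (Rs `|` [set inv_graph g | g in Rs]) r &
      exists2 y, r (x, y) & A y].

(* Number of elements of a finite subset of X; fset_set needs a choiceType,
   which {classic X} provides for any X. The value is 0 on infinite sets, but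
   the boundary of a finite set with respect to a finite set of partial
   bijections is always finite. *)
Definition card (X : Type) (A : set X) : nat :=
  #|` fset_set (A : set {classic X})|.

Definition folner (R : realType) (X : Type) (G : set (set (X * X))) : Prop :=
  forall Rs : set (set (X * X)), Rs `<=` G -> finite_set Rs ->
  forall eps : R, 0 < eps ->
  exists F : set X, [/\ finite_set F, F !=set0 &
    (card (boundary Rs F))%:R < eps * (card F)%:R].

(* Main.v *)
(* If the Folner condition holds, the sets F that are almost invariant under
   larger and larger finite subsets of G form a filter base; along an ultrafilter
   refining it, the densities |S `&` F| / |F| converge to an invariant mean.
   Conversely, if the Folner condition fails for Rs and eps >= 1/k, then the
   neighbourhood of every finite F under Rs, its inverses and the identity has at
   least (1 + 1/k)|F| elements, so Hall's theorem for the infinite locally finite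
   bipartite graph gives an injection of k+1 copies of X into k copies of X that
   moves each point along one of finitely many elements of G; cutting it into
   the pieces where a given element is used, an invariant mean would give
   k+1 <= k. *)
Require Import Defs.
From mathcomp Require Import all_boot all_order all_algebra.
From mathcomp Require Import finmap zify.
From mathcomp Require Import boolp classical_sets functions cardinality filter reals.
From mathcomp Require Import topology normedtype.

Import numFieldNormedType.Exports.

Set Implicit Arguments.
Unset Strict Implicit.
Unset Printing Implicit Defensive.

Import Order.TTheory GRing.Theory Num.Theory.

Local Open Scope classical_set_scope.

(** * Hall's marriage theorem for locally finite bipartite graphs *)

Definition nbrs (I T : choiceType) (N : I -> {fset T}) (A : {fset I}) :
  {fset T} := (\bigcup_(i <- A) N i)%fset.

Lemma in_nbrs (I T : choiceType) (N : I -> {fset T}) (A : {fset I}) x :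
  reflect (exists2 i, i \in A & x \in N i) (x \in nbrs N A).
Proof.
apply: (iffP (bigfcupP _ _ _ _)) => -[i].
  by rewrite andbT; exists i.
by exists i; rewrite ?andbT.
Qed.

Definition hall_condition (I T : choiceType) (S : {fset I})
    (N : I -> {fset T}) : Prop :=
  forall A, (A `<=` S)%fset -> #|` A| <= #|` nbrs N A|.

(* Rado's step: if both removals violated the condition, on A1 and A2, then
   submodularity of A |-> #|nbrs N A| would violate it on A1 `|` A2 or on
   (A1 `&` A2) `\ i. *)
Lemma hall_condition_remove (I T : choiceType) (S : {fset I})
    (N : I -> {fset T}) (i : I) (x1 x2 : T) :
  x1 != x2 -> hall_condition S N ->
  exists2 x, x \in [:: x1; x2] &
    hall_condition S (fun j => if j == i then N i `\ x else N j)%fset.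
Proof.
move=> x12 hallN; pose M x j := (if j == i then N i `\ x else N j)%fset.
have [h|/existsNP[A1]] := pselect (hall_condition S (M x1)).
  by exists x1; rewrite ?inE ?eqxx.
move=> /not_implyP[sA1 /negP]; rewrite -ltnNge => lt1.
exists x2; first by rewrite !inE eqxx orbT.
apply: contrapT => /existsNP[A2] /not_implyP[sA2 /negP].
rewrite -ltnNge -/(M x2) => lt2.
(* A violating set contains [i], since away from [i] the families [M x] and [N] agree. *)
have iA x A : (A `<=` S)%fset -> #|` nbrs (M x) A| < #|` A| -> i \in A.
  move=> sA ltA; apply: contraLR ltA => iNA; rewrite -leqNgt.
  rewrite (leq_trans (hallN A sA))// fsubset_leq_card//.
  apply/fsubsetP => y /in_nbrs[j jA yj]; apply/in_nbrs; exists j => //.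
  by rewrite /M; case: eqP jA iNA => // -> ->.
have iA1 := iA _ _ sA1 lt1; have iA2 := iA _ _ sA2 lt2.
have leU : #|` (A1 `|` A2)%fset| <= #|` (nbrs (M x1) A1 `|` nbrs (M x2) A2)%fset|.
  apply: leq_trans (hallN _ _) _; first by rewrite fsubUset sA1.
  apply/fsubset_leq_card/fsubsetP => y /in_nbrs[j + yj]; rewrite !inE.
  have [ji|ji] := eqVneq j i; last first.
    by move=> /orP[] jA; apply/orP; [left|right]; apply/in_nbrs;
      exists j; rewrite // /M (negPf ji).
  rewrite ji in yj; move=> _; apply/orP.
  have [yx1|yx1] := eqVneq y x1; [right|left]; apply/in_nbrs; exists i => //;
    by rewrite /M eqxx !inE yj andbT ?yx1.
have leI : #|` ((A1 `&` A2) `\ i)%fset| <=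
    #|` (nbrs (M x1) A1 `&` nbrs (M x2) A2)%fset|.
  apply: leq_trans (hallN _ _) _.
    by rewrite fsubDset (fsubset_trans (fsubsetIl _ _))// fsubsetU ?sA1 ?orbT.
  apply/fsubset_leq_card/fsubsetP => y /in_nbrs[j]; rewrite !inE.
  move=> /and3P[ji jA1 jA2] yj.
  by apply/andP; split; apply/in_nbrs; exists j; rewrite // /M (negPf ji).
(* The left sides of [leU] and [leI] add up to |A1| + |A2| - 1, while by [lt1] and [lt2] the right
   sides add up to at most |A1| + |A2| - 2. *)
have := cardfsD1 i (A1 `&` A2)%fset; rewrite !inE iA1 iA2.
have := cardfsUI A1 A2.
have := cardfsUI (nbrs (M x1) A1) (nbrs (M x2) A2).
rewrite -/(M x1) in lt1; lia.
Qed.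

(** Induction on the number of edges: Rado's step deletes one as long as some vertex has two
    neighbours. Once each [N i] has at most one element, Hall's condition on singletons makes it
    non-empty and on pairs makes the choice injective. *)
Lemma hall_finite (I T : choiceType) (t0 : T) (S : {fset I})
    (N : I -> {fset T}) :
  hall_condition S N ->
  exists f : I -> T, {in S, forall i, f i \in N i} /\ {in S &, injective f}.
Proof.
have [n] := ubnP (\sum_(i <- S) #|` N i|).
elim: n N => // n IHn N ltn hallN.
have [[i [iS [x1 [x2 [x1i x2i x12]]]]]|uniqN] := pselect (exists i, i \in S /\
    exists x1 x2, [/\ x1 \in N i, x2 \in N i & x1 != x2]).
  have [x xx hallM] := hall_condition_remove i x12 hallN.
  have [|f [fN finj]] := IHn _ _ hallM.
    rewrite -ltnS; apply: leq_trans ltn; rewrite ltnS !(big_fsetD1 i iS)/= eqxx.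
    rewrite -addSn leq_add//.
      have xi : x \in N i by move: xx; rewrite !inE => /orP[] /eqP->.
      by rewrite [leqRHS](cardfsD1 x) xi.
    rewrite big_seq [leqRHS]big_seq leq_sum// => j.
    by rewrite !inE => /andP[/negPf->].
  exists f; split => // j /fN.
  by case: eqP => [->|//]; rewrite inE => /andP[].
exists (fun i => head t0 (N i)).
have fN i : i \in S -> head t0 (N i) \in N i.
  move=> iS; have /hallN : ([fset i] `<=` S)%fset by rewrite fsub1set.
  rewrite cardfs1 cardfs_gt0 => /fset0Pn[y /in_nbrs[_ /fset1P-> yi]].
  rewrite -[_ \in N i]/(_ \in enum_fset (N i)).
  have : y \in enum_fset (N i) by [].
  by case: (enum_fset (N i)) => //= a l _; rewrite mem_head.
split=> // i j iS jS fij; apply: contraPP (hallN [fset i; j]%fset _).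
  move=> /eqP ij; apply/negP; rewrite -ltnNge cardfs2 ij ltnS.
  rewrite -[leqRHS](cardfs1 (head t0 (N i))).
  apply/fsubset_leq_card/fsubsetP => y /in_nbrs[k]; rewrite !inE => kij yk.
  have kS : k \in S by case/orP: kij => /eqP->.
  have -> : head t0 (N i) = head t0 (N k) by case/orP: kij => /eqP->.
  apply/negPn/negP => ne; apply: uniqN; exists k; split=> //.
  by exists y, (head t0 (N k)); split=> //; exact: fN.
by apply/fsubsetP => k; rewrite !inE => /orP[] /eqP->.
Qed.

(** Otherwise the complements of the fibres over [D] would all lie in [U], and so would their finite
    intersection, which misses the preimage of [D]. *)
Lemma ultra_fset_choice (Z : Type) (T : choiceType) (U : set_system Z)
    (D : {fset T}) (f : Z -> T) :
  UltraFilter U -> U [set z | f z \in D] ->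
  exists2 y, y \in D & U [set z | f z = y].
Proof.
move=> UU UD; apply: contrapT => nU.
have UC : U (\bigcap_(y in [set` D]) ~` [set z | f z = y]).
  apply: filter_bigI => y yD.
  have [Uy|//] := in_ultra_setVsetC [set z | f z = y] UU.
  by case: nU; exists y.
have [z [zD zC]] := filter_ex (filterI UD UC).
exact: (zC (f z)).
Qed.

(** Compactness: the matchings [f S] of finite sets [S] are glued along an ultrafilter containing
    every cone [above S]. As [N i] is finite, [f S i] is constant for [U]-almost all [S];
    injectivity at two vertices is read off from a single [S]. *)
Theorem hall (I T : choiceType) (N : I -> {fset T}) :
  (forall A, #|` A| <= #|` nbrs N A|) ->
  exists f : I -> T, (forall i, f i \in N i) /\ injective f.
Proof.
move=> hallN.
have [[i0 _]|noI] := pselect (exists i : I, True); last first.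
  have noI' (i : I) : False by apply: noI; exists i.
  by exists (fun i => False_rect T (noI' i)); split => i; case: (noI' i).
have [t0 _] : exists t, t \in nbrs N [fset i0]%fset.
  by apply/fset0Pn; rewrite -cardfs_gt0 -(cardfs1 i0).
have /choice[f fP] : forall S : {fset I}, exists f : I -> T,
    {in S, forall i, f i \in N i} /\ {in S &, injective f}.
  by move=> S; apply: hall_finite => // A _.
pose above (S : {fset I}) := [set S' | (S `<=` S')%fset].
have Fproper : ProperFilter (filter_from setT above).
  apply: filter_from_proper => [|S _]; last by exists S; exact: fsubset_refl.
  apply: filter_from_filter; first by exists fset0.
  move=> S S' _ _; exists (S `|` S')%fset => // S'' /=.
  by rewrite /above/= fsubUset => /andP.
have [U [UU sU]] := ultraFilterLemma Fproper.
have Umem i : U [set S : {fset I} | i \in S].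
  by apply: sU; exists [fset i]%fset => // S; rewrite /above/= fsub1set.
have /choice[g gP] : forall i, exists y, y \in N i /\ U [set S | f S i = y].
  move=> i; have [|y yi Uy] := @ultra_fset_choice _ _ U (N i) (f ^~ i) UU; last by exists y.
  by apply: filterS (Umem i) => S /=; exact: (fP S).1.
exists g; split=> [i|i j gij]; first exact: (gP i).1.
have [S [[/= Si Sj] [fi fj]]] := filter_ex (filterI
  (filterI (Umem i) (Umem j)) (filterI (gP i).2 (gP j).2)).
by apply: (fP S).2 => //; rewrite fi fj.
Qed.

Local Open Scope ring_scope.

(** * Finite additivity of means, and finiteness of boundaries *)

Lemma mean_finite_sum (R : realType) (X : Type) (G : set (set (X * X)))
    (mu : set X -> R) (I : finType) (B : I -> set X) :
  is_invariant_mean G mu -> trivIset setT B ->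
  mu (\bigcup_i B i) = \sum_i mu (B i).
Proof.
move=> muP trivB; have mu0 : mu set0 = 0.
  have := mean_additive muP (setI0 set0); rewrite setU0 => /eqP.
  by rewrite -subr_eq subrr => /eqP.
have -> : [set: I] = [set` index_enum I].
  by apply/seteqP; split=> i //= _; rewrite mem_index_enum.
rewrite bigcup_seq.
elim: (index_enum I) (index_enum_uniq I) => [_|i s IHs /= /andP[iNs us]].
  by rewrite !big_nil.
rewrite !big_cons (mean_additive muP) ?IHs// -bigcup_seq.
rewrite -subset0 => x [Bix [j /= js Bjx]].
have ij : i = j by apply: (trivB i j) => //; exists x.
by rewrite ij js in iNs.
Qed.

(** Unlike [boundary], this keeps the points of [A] and does not add inverses to [Rs]. *)
Definition neighbors (X : Type) (Rs : set (set (X * X))) (A : set X) : set X :=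
  [set x | exists2 r, Rs r & exists2 y, r (x, y) & A y].

Lemma finite_neighbors (X : Type) (Rs : set (set (X * X))) (A : set X) :
  (forall r, Rs r -> partial_bij r) -> finite_set Rs -> finite_set A ->
  finite_set (neighbors Rs A).
Proof.
move=> bijRs finRs finA; pose P (r : set (X * X)) (y : X) := [set x | r (x, y)].
apply: (@sub_finite_set _ _ (\bigcup_(r in Rs) \bigcup_(y in A) P r y)).
  by move=> x [r Rr [y rxy Ay]]; exists r => //; exists y.
apply: bigcup_finite => // r Rr; apply: bigcup_finite => // y _.
have [[x rxy]|noP] := pselect (exists x, r (x, y)).
  apply: (@sub_finite_set _ _ [set x]) => // x' rx'y.
  by have [_ /(_ _ _ _ rx'y rxy)] := bijRs r Rr.
by apply: (@sub_finite_set _ _ set0) => // x rxy; apply: noP; exists x.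
Qed.

Lemma finite_setU_inv_graph (X : Type) (Rs : set (set (X * X))) :
  finite_set Rs -> finite_set (Rs `|` [set inv_graph g | g in Rs]).
Proof. by move=> ?; rewrite finite_setU; split=> //; exact: finite_image. Qed.

Lemma setU_inv_graph_sub (X : Type) (G Rs : set (set (X * X))) :
  is_pseudogroup G -> Rs `<=` G -> Rs `|` [set inv_graph g | g in Rs] `<=` G.
Proof.
by move=> hG RsG r [/RsG//|[g /RsG Gg <-]]; exact: pseudogroup_inv.
Qed.

Lemma finite_boundary (X : Type) (G Rs : set (set (X * X))) (A : set X) :
  is_pseudogroup G -> Rs `<=` G -> finite_set Rs -> finite_set A ->
  finite_set (boundary Rs A).
Proof.
move=> hG RsG finRs finA.
apply: sub_finite_set (finite_neighbors (A := A) _ (finite_setU_inv_graph finRs) finA).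
  by move=> x [].
by move=> r /(setU_inv_graph_sub hG RsG); exact: pseudogroup_bij.
Qed.

(** * Amenability implies the Folner condition *)

Lemma card_fsetM (K K' : choiceType) (A : {fset K}) (B : {fset K'}) :
  #|` (A `*` B)%fset| = (#|` A| * #|` B|)%N.
Proof.
rewrite -(size_allpairs pair A B); apply/perm_size/uniq_perm.
- exact: fset_uniq.
- by apply: allpairs_uniq; rewrite ?fset_uniq// => -[? ?] [? ?].
- move=> [x y]; rewrite in_fsetM /=; apply/andP/allpairsP => /=.
    by move=> [xA yB]; exists (x, y).
  by move=> [[x' y'] [? ? [-> ->]]].
Qed.

Lemma card_fsetE (X : Type) (F : {fset {classic X}}) :
  Defs.card ([set` F] : set X) = #|` F|.
Proof. by rewrite /Defs.card set_fsetK. Qed.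

(** Double counting of mass, with the points of copy [i] sorted by their target copy [j] and the
    graph [r] used. For fixed [i] the pieces partition [X] and have total mass 1; for fixed [j]
    their images are disjoint by injectivity of [f] and have total mass at most 1. Invariance
    equates the two totals, so k+1 <= k. *)
Lemma mean_no_overpacking (R : realType) (X : Type) (G : set (set (X * X)))
    (mu : set X -> R) (K : {fset {classic set (X * X)}}) (k : nat)
    (f : {classic X} * 'I_k.+1 -> {classic X} * 'I_k) :
  is_pseudogroup G -> is_invariant_mean G mu ->
  (forall r : set (X * X), (r : {classic _}) \in K -> G r) ->
  (forall p, exists2 r : set (X * X), (r : {classic _}) \in K & r (p.1, (f p).1)) ->
  ~ injective f.
Proof.
move=> hG muP KG fK finj.
(* Choosing one graph per point keeps the pieces disjoint even where several graphs of [K] would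
   do. *)
have /choice[c cP] : forall p, exists r : K,
    (val r : set (X * X)) (p.1, (f p).1).
  by move=> p; have [r rK rp] := fK p; exists [` rK]%fset.
pose A (i : 'I_k.+1) (jr : 'I_k * K) : set X :=
  [set x | (f (x, i)).2 = jr.1 /\ c (x, i) = jr.2].
pose B (i : 'I_k.+1) (jr : 'I_k * K) := restr_graph (val jr.2) (A i jr).
have Aalpha i jr : A i jr `<=` alpha (val jr.2 : set (X * X)).
  by move=> x [_ <-]; exists (f (x, i)).1; exact: cP.
have GB i jr : G (B i jr).
  by apply: pseudogroup_restr => //; apply: KG; exact: valP.
have muB i jr : mu (omega (B i jr)) = mu (A i jr).
  rewrite (mean_invariant muP (GB i jr)); congr mu; apply/seteqP; split=> x.
    by case=> y [].
  by move=> Ax; have [y xy] := Aalpha _ _ _ Ax; exists y.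
have muA i : \sum_jr mu (A i jr) = 1.
  rewrite -(mean_normalized muP) -(mean_finite_sum muP).
    congr mu; apply/seteqP; split=> x // _.
    by exists ((f (x, i)).2, c (x, i)).
  by move=> [j r] [j' r'] _ _ [x [[/= <- <-] [/= <- <-]]].
have Bj j : \sum_i \sum_r mu (omega (B i (j, r))) <= 1.
  rewrite pair_big/= -(mean_finite_sum muP (B := fun ir => omega (B ir.1 (j, ir.2)))).
    by have /andP[] := mean_range muP (\bigcup_ir omega (B ir.1 (j, ir.2))).
  move=> [i r] [i' r'] _ _ /= [y [[x [/= rxy [/= fj cr]]] [x' [/= rxy' [/= fj' cr']]]]].
  have fE (z : X) l s : (val s : set (X * X)) (z, y) -> (f (z, l)).2 = j ->
      c (z, l) = s -> f (z, l) = (y : {classic X}, j).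
    move=> szy zj zs; rewrite [LHS]surjective_pairing zj; congr pair.
    have := cP (z, l); rewrite zs => /= szf.
    have [+ _] := pseudogroup_bij hG (KG _ (valP s)).
    by move=> /(_ _ _ _ szf szy).
  have [] : (x : {classic X}, i) = (x' : {classic X}, i').
    exact: finj (etrans (fE x i r rxy fj cr) (esym (fE x' i' r' rxy' fj' cr'))).
  by move=> xx' ii'; rewrite -cr -cr' xx' ii'.
have : (k.+1%:R : R) <= k%:R.
  have -> : k.+1%:R = \sum_(i < k.+1) \sum_jr mu (A i jr).
    by rewrite (eq_bigr (fun=> 1)) ?sumr_const ?card_ord.
  have -> : (k%:R : R) = \sum_(j < k) 1 by rewrite sumr_const card_ord.
  rewrite [leLHS](_ : _ = \sum_j \sum_i \sum_r mu (omega (B i (j, r)))).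
    exact: ler_sum.
  rewrite [RHS]exchange_big/=; apply: eq_bigr => i _.
  rewrite [RHS]pair_big/=; apply: eq_bigr => -[j r] _; exact/esym/muB.
by rewrite ler_nat ltnn.
Qed.

Lemma amenable_folner (R : realType) (X : Type) (G : set (set (X * X))) :
  is_pseudogroup G -> amenable R G -> folner R G.
Proof.
move=> hG [mu muP] Rs RsG finRs eps eps0; apply: contrapT => noF.
have finB (F : {fset {classic X}}) : finite_set (boundary Rs [set` F]).
  exact: (finite_boundary hG RsG finRs (finite_fset F)).
have bigB (F : {fset {classic X}}) :
    eps * #|` F|%:R <= (Defs.card (boundary Rs [set` F]))%:R.
  have [->|/fset0Pn[x xF]] := eqVneq F fset0; first by rewrite cardfs0 mulr0.
  rewrite leNgt; apply/negP => ltF; apply: noF; exists [set` F].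
  split; [exact: (finite_fset F)|by exists x|].
  by rewrite [X in _ * X%:R](card_fsetE F).
(* With [k * eps >= 1], [bigB] says that the boundary of [F] has at least |F|/k points. *)
pose k := (Num.truncn eps^-1).+1.
have keps : 1 <= k%:R * eps.
  by rewrite -ler_pdivrMr// div1r ltW// truncnS_gt.
(* The diagonal puts [P] itself among its neighbours; closure under inverses lets the edges of [N],
   which run from a neighbour back to [p], be reversed at the end. *)
pose Ks : set (set (X * X)) :=
  Rs `|` [set inv_graph g | g in Rs] `|` [set diagonal].
have finKs : finite_set Ks by rewrite finite_setU; split=> //; exact: finite_setU_inv_graph.
pose K := fset_set (Ks : set {classic set (X * X)}).
have inK (r : set (X * X)) : ((r : {classic _}) \in K) = `[< Ks r >].
  by rewrite in_fset_set.
have KsG : Ks `<=` G.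
  by move=> r [/(setU_inv_graph_sub hG RsG)//|->]; exact: pseudogroup_id.
have Ksinv r : Ks r -> Ks (inv_graph r).
  case=> [[Rr|[g Rg <-]]|->].
  - by left; right; exists r.
  - by left; left; rewrite (_ : inv_graph _ = g)//; apply/seteqP; split => -[].
  - by right; apply/seteqP; split => -[x y] /= /esym.
have finnb A : finite_set A -> finite_set (neighbors Ks A).
  by apply: finite_neighbors => // r /KsG; exact: pseudogroup_bij.
pose nb (A : set X) := fset_set (neighbors Ks A : set {classic X}).
pose N (p : {classic X} * 'I_k.+1) : {fset {classic X} * 'I_k} :=
  (nb [set (p.1 : X)] `*` [fset j | j in 'I_k])%fset.
have in_nb A x : finite_set A -> (x \in nb A) = `[< neighbors Ks A x >].
  by move=> finA; rewrite in_fset_set//; exact: finnb.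
have [A|f [fN finj]] := @hall _ _ N.
  (* With b the size of the boundary of [P], Hall's condition follows from |A| <= (k+1)|P| <= k(|P|
     + b) <= k|nb P| <= |nbrs N A|. *)
  pose P := [fset p.1 | p in A]%fset.
  have leA : (#|` A| <= #|` P| * k.+1)%N.
    rewrite -[X in (_ * X)%N]card_ord -card_finset -card_fsetM.
    apply/fsubset_leq_card/fsubsetP => p pA; rewrite in_fsetM; apply/andP; split.
      by apply/imfsetP; exists p.
    by rewrite !inE.
  have leN : (#|` nb [set` P]| * k <= #|` nbrs N A|)%N.
    rewrite -[X in (_ * X)%N]card_ord -card_finset -card_fsetM.
    apply/fsubset_leq_card/fsubsetP => -[y j]; rewrite in_fsetM => /andP[+ _].
    rewrite (in_nb _ _ (finite_fset P)) => /asboolP[r Kr [x ryx /= /imfsetP[p /= pA xp]]].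
    apply/in_nbrs; exists p => //; rewrite in_fsetM /= !inE andbT in_nb//.
    by apply/asboolP; exists r => //; exists p.1; rewrite // -xp.
  have leP : (#|` P| + Defs.card (boundary Rs [set` P]) <= #|` nb [set` P]|)%N.
    pose bP := fset_set (boundary Rs [set` P] : set {classic X}).
    have PbP : (P `&` bP)%fset = fset0.
      apply/fsetP => x; rewrite !inE in_fset_set//; apply/negP => /andP[xP].
      by rewrite inE => -[/(_ xP)].
    have := cardfsUI P bP; rewrite PbP cardfs0 addn0 => <-.
    apply/fsubset_leq_card/fsubsetP => x; rewrite !inE (in_nb _ _ (finite_fset P)) => xU.
    apply/asboolP; case/orP: xU => [xP|].
      by exists diagonal; [right|exists x].
    by rewrite in_fset_set// inE => -[_ [r Kr [y rxy yP]]]; exists r; [left|exists y].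
  have leb : (#|` P| <= k * Defs.card (boundary Rs [set` P]))%N.
    rewrite -(ler_nat R) natrM; apply: le_trans (ler_wpM2l (ler0n R k) (bigB P)).
    by rewrite mulrA ler_peMl.
  nia.
apply: (@mean_no_overpacking R X G mu K k f hG muP _ _ finj).
  by move=> r; rewrite inK => /asboolP /KsG.
move=> p; have := fN p; rewrite in_fsetM => /andP[+ _].
rewrite in_nb// => /asboolP[r Kr [x rx xp]]; exists (inv_graph r); last by rewrite -xp.
by rewrite inK; apply/asboolP; exact: Ksinv.
Qed.

(** * The Folner condition implies amenability *)

Lemma ultra_bounded_cvg (R : realType) (Z : Type) (U : set_system Z)
    (a b : R) (u : Z -> R) :
  UltraFilter U -> (forall z, a <= u z <= b) ->
  exists2 l, a <= l <= b & u z @[z --> U] --> l.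
Proof.
move=> UU uab; have Uab : (u z @[z --> U]) `[a, b]%classic.
  by apply: (@filterE _ U) => z; rewrite /= in_itv; exact: uab.
have [l [/=]] := segment_compact _ Uab; rewrite in_itv /= => lab ul.
exists l => // B Bl; have [//|UC] := in_ultra_setVsetC (u @^-1` B) UU.
by have [x [nBx /nBx]] := ul (~` B) B UC Bl.
Qed.

Lemma inv_graphK (X : Type) (g : set (X * X)) : inv_graph (inv_graph g) = g.
Proof. by apply/seteqP; split => -[]. Qed.

(** The graph [g] sends the points of [F] in its domain injectively into its range; an image outside
    [F] is led back into [F] by the inverse of [g], so it lies in the boundary. *)
Lemma leq_card_alpha_omega (X : Type) (Rs : set (set (X * X)))
    (g : set (X * X)) (F : {fset {classic X}}) :
  partial_bij g -> (Rs `|` [set inv_graph r | r in Rs]) (inv_graph g) ->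
  finite_set (boundary Rs [set` F]) ->
  (#|` [fset x in F | `[< alpha g x >]]%fset| <=
   #|` [fset x in F | `[< omega g x >]]%fset| +
   Defs.card (boundary Rs [set` F]))%N.
Proof.
move=> [gfun ginj] Rg finb; pose T := {classic X}.
have /choice[h hP] : forall x : T, exists y : T, forall y', g (x, y') -> y' = y.
  move=> x; have [[y gxy]|nog] := pselect (exists y, g (x, y)).
    by exists y => y' /gfun; exact.
  by exists x => y gxy; case: nog; exists y.
have gh (x : T) : alpha g x -> g (x, h x) by case=> y gxy; rewrite -(hP x y gxy).
set Fa := [fset x in F | `[< alpha g x >]]%fset.
have hinj : {in Fa &, injective h}.
  move=> x x'; rewrite !inE => /andP[_ /asboolP/gh xh] /andP[_ /asboolP/gh xh'] hxx'.
  by rewrite -hxx' in xh'; exact: ginj xh xh'.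
have <- : #|` [fset h x | x in Fa]%fset| = #|` Fa| by rewrite card_in_imfset.
apply: leq_trans (leq_card_fsetU _ _).1.
apply/fsubset_leq_card/fsubsetP => y /imfsetP[x /=].
rewrite !inE => /andP[xF /asboolP/gh gxh] ->.
have [hF|hF] := boolP (h x \in F).
  by apply/orP; left; apply/asboolP; exists x.
rewrite in_fset_set// inE; split; first exact/negP.
by exists (inv_graph g) => //; exists x.
Qed.

Lemma folner_amenable (R : realType) (X : Type) (G : set (set (X * X))) :
  is_pseudogroup G -> folner R G -> amenable R G.
Proof.
move=> hG folG; pose T := {classic X}.
pose D := [set p : set (set (X * X)) * R |
  [/\ p.1 `<=` G, finite_set p.1 & 0 < p.2]].
(* These sets form a filter base: the Folner condition makes them non-empty, and the union of the
   graph sets with the smaller tolerance refines two of them. *)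
pose B (p : set (set (X * X)) * R) := [set F : {fset T} | F != fset0 /\
  (Defs.card (boundary p.1 [set` F]))%:R < p.2 * #|` F|%:R].
have Fproper : ProperFilter (filter_from D B).
  apply: filter_from_proper; last first.
    move=> [Rs eps] [/= RsG finRs eps0].
    have [F [finF [x Fx] ltF]] := folG Rs RsG finRs eps eps0.
    exists (fset_set (F : set T)); split=> /=; last by rewrite fset_setK.
    by apply/fset0Pn; exists x; rewrite in_fset_set// inE.
  apply: filter_from_filter.
    by exists (set0, 1); split => //=; exact: finite_set0.
  move=> [R1 e1] [R2 e2] [/= G1 fin1 e10] [/= G2 fin2 e20].
  exists (R1 `|` R2, Order.min e1 e2).
    by split => /=; rewrite ?subUset ?finite_setU ?lt_min ?e10.
  have G12 : R1 `|` R2 `<=` G by rewrite subUset.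
  have fin12 : finite_set (R1 `|` R2) by rewrite finite_setU.
  have mono (R' : set (set (X * X))) e' (F : {fset T}) : R' `<=` R1 `|` R2 ->
      Order.min e1 e2 <= e' -> B (R1 `|` R2, Order.min e1 e2) F -> B (R', e') F.
    move=> sR' lee' [F0 /= ltF]; split=> //=.
    apply: le_lt_trans (lt_le_trans ltF _); last by rewrite ler_wpM2r.
    have finb := finite_boundary hG G12 fin12 (finite_fset F).
    have sb : boundary R' [set` F] `<=` boundary (R1 `|` R2) [set` F].
      move=> x [Fx [r R'r rx]]; split=> //; exists r => //.
      case: R'r => [/sR'|[g /sR' R'g <-]]; first by left.
      by right; exists g.
    rewrite ler_nat; apply/fsubset_leq_card/fsubsetP => x.
    rewrite !in_fset_set ?inE; [exact: sb|exact: finb|exact: sub_finite_set sb finb].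
  move=> F BF; split; apply: mono BF.
  - exact: subsetUl.
  - by rewrite ge_min lexx ?orbT.
  - exact: subsetUr.
  - by rewrite ge_min lexx ?orbT.
have [U [UU sU]] := ultraFilterLemma Fproper.
pose n (S : set X) (F : {fset T}) := #|` [fset x in F | `[< S x >]]%fset|.
pose u (S : set X) (F : {fset T}) : R := (n S F)%:R / #|` F|%:R.
have u01 S F : 0 <= u S F <= 1.
  (* Division by zero gives the empty [F] density 0. *)
  rewrite divr_ge0//=; have [->|F0] := eqVneq F fset0.
    by rewrite /u cardfs0 invr0 mulr0.
  rewrite ler_pdivrMr ?ltr0n ?cardfs_gt0// mul1r ler_nat.
  by apply/fsubset_leq_card/fsubsetP => x; rewrite !inE => /andP[].
have /choice[mu muP] : forall S, exists l : R, 0 <= l <= 1 /\ u S F @[F --> U] --> l.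
  by move=> S; have [l] := ultra_bounded_cvg UU (u01 S); exists l.
have Ulim (v : {fset T} -> R) (l l' : R) : v F @[F --> U] --> l ->
    v F @[F --> U] --> l' -> l = l'.
  by move=> vl vl'; apply: cvg_unique vl vl'; exact: norm_hausdorff.
exists mu; split.
- by move=> S; have [] := muP S.
- move=> S1 S2 S12; apply: Ulim (muP _).2 _.
  rewrite (_ : u _ = u S1 \+ u S2); first by apply: cvgD; [exact: (muP S1).2|exact: (muP S2).2].
  apply/funext => F; rewrite /u /= -mulrDl -natrD; congr (_%:R / _).
  rewrite /n -cardfsUI [X in (_ + #|` X|)%N](_ : _ = fset0).
    rewrite cardfs0 addn0; congr #|` _|; apply/fsetP => x; rewrite !inE.
    by rewrite -andb_orr -asbool_or.
  apply/fsetP => x; rewrite !inE; apply/negP => /andP[/andP[_ /asboolP x1]].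
  by move=> /andP[_ /asboolP x2]; have : (S1 `&` S2) x by []; rewrite S12.
(* The two densities differ by at most the boundary of [F] for [[set g]] divided by |F|, which is
   below [e] on a base set. The lower and upper bounds come from the same lemma, for [g] and for its
   inverse. *)
- move=> g Gg; apply/eqP; rewrite -subr_eq0; apply/eqP.
  apply: Ulim (cvgB (muP _).2 (muP _).2) _; apply/cvgr0Pnorm_lt => e e0.
  apply: sU; exists ([set g], e) => //; first by split => //= r ->.
  move=> F [F0 /= ltF]; rewrite /u -mulrBl normrM normfV normr_nat.
  rewrite ltr_pdivrMr ?ltr0n ?cardfs_gt0//; apply: le_lt_trans ltF.
  have bijg := pseudogroup_bij hG Gg.
  have finb : finite_set (boundary [set g] [set` F]).
    by apply: (finite_boundary hG _ _ (finite_fset F)) => // r ->.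
  have ao := leq_card_alpha_omega bijg (or_intror (imageP _ erefl)) finb.
  have oa : (n (omega g) F <= n (alpha g) F + Defs.card (boundary [set g] [set` F]))%N.
    apply: (leq_card_alpha_omega (g := inv_graph g) _ _ finb).
      exact: (pseudogroup_bij hG (pseudogroup_inv hG Gg)).
    by left; rewrite inv_graphK.
  by rewrite ler_norml lerBrDl lerBlDr lerBlDl -!natrD !ler_nat ao oa.
(* Any base set will do: it contains only non-empty [F], on which [X] has density exactly 1. *)
- apply: Ulim (muP _).2 _; apply: cvg_near_cst.
  apply: sU; exists (set0, 1); first by split => //=; exact: finite_set0.
  move=> F [F0 _]; rewrite /u /n.
  rewrite (_ : [fset x in F | _]%fset = F) ?divff ?pnatr_eq0 ?cardfs_eq0//.
  by apply/fsetP => x; rewrite !inE asboolT ?andbT.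
Qed.

Theorem theorem25 (R : realType) (X : Type) (G : set (set (X * X)))
  (hG : is_pseudogroup G) :
  amenable R G <-> folner R G.
Proof. by split; [exact: amenable_folner|exact: folner_amenable]. Qed.
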